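(* The axiomatic system $\mathbb{E}^\Delta$ is sound and strongly complete with respect to the class of $c$-frames under the semantics $\Vvdash$: for all $\Gamma\cup\{\phi\}\subseteq\mathcal{L}_\Delta$, $\phi$ is derivable from $\Gamma$ in $\mathbb{E}^\Delta$ if and only if, for every model $\mathcal{M}$ based on a $c$-frame and every state $s$, if $\mathcal{M},s\Vvdash\psi$ for all $\psi\in\Gamma$ then $\mathcal{M},s\Vvdash\phi$.
   Context: $\mathcal{L}_\Delta$: $\phi::=p\mid\neg\phi\mid(\phi\land\phi)\mid\Delta\phi$, $p$ in a countable set $\mathbf{Prop}$. $\mathbb{E}^\Delta$ has axioms: all instances of propositional tautologies, and $\Delta\phi\leftrightarrow\Delta\neg\phi$; rules: modus ponens and from $\phi\leftrightarrow\psi$ infer $\Delta\phi\leftrightarrow\Delta\psi$. $\phi$ is derivable from $\Gamma$ if $\bigwedge\Gamma_0\to\phi$ is a theorem for some finite $\Gamma_0\subseteq\Gamma$. A neighborhood frame is $\langle S,N\rangle$ with $S\neq\emptyset$, $N:S\to 2^{2^S}$; it is a $c$-frame if for all $s$, $X\in N(s)$ implies $S\setminus X\in N(s)$. Semantics $\Vvdash$: $s\Vvdash p$ iff $s\in V(p)$, Boolean clauses standard, $\mathcal{M},s\Vvdash\Delta\phi$ iff $\{t:\mathcal{M},t\Vvdash\phi\}\in N(s)$. *)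

(* Defs.v *)
From Stdlib Require List.
From mathcomp Require Import all_boot all_classical.

Set Implicit Arguments.
Unset Strict Implicit.
Unset Printing Implicit Defensive.

Local Open Scope classical_set_scope.

Inductive form (Atom : Type) : Type :=
| Var of Atom
| Neg of form Atom
| And of form Atom & form Atom
| Delta of form Atom.

Definition Imp (Atom : Type) (phi psi : form Atom) : form Atom :=
  Neg (And phi (Neg psi)).

Definition Iff (Atom : Type) (phi psi : form Atom) : form Atom :=
  And (Imp phi psi) (Imp psi phi).

(* The language has no constant for truth, and there need not be a
   distinguished atom, so truth is written as [~ (phi /\ ~ phi)]. *)
Definition Top (Atom : Type) (phi : form Atom) : form Atom :=
  Neg (And phi (Neg phi)).

(* The conjunction of a finite list, ending with [Top phi], which is thus the
   value of the empty conjunction; the choice of [phi] is immaterial. *)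
Definition bigAnd (Atom : Type) (phi : form Atom) (l : seq (form Atom)) :
  form Atom := foldr (@And Atom) (Top phi) l.

(* Formulas of classical propositional logic over variables indexed by [nat];
   the variables are schematic and independent of the atoms of [form]. *)
Inductive pform : Type :=
| PVar of nat
| PNeg of pform
| PAnd of pform & pform.

Fixpoint peval (v : nat -> bool) (a : pform) : bool :=
  match a with
  | PVar n => v n
  | PNeg b => ~~ peval v b
  | PAnd b c => peval v b && peval v c
  end.

Definition tautology (a : pform) : Prop := forall v, peval v a.

Fixpoint psubst (Atom : Type) (sigma : nat -> form Atom) (a : pform) :
  form Atom :=
  match a with
  | PVar n => sigma n
  | PNeg b => Neg (psubst sigma b)
  | PAnd b c => And (psubst sigma b) (psubst sigma c)
  end.

Inductive EDelta (Atom : Type) : form Atom -> Prop :=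
| EDelta_taut (a : pform) (sigma : nat -> form Atom) :
    tautology a -> EDelta (psubst sigma a)
| EDelta_equ (phi : form Atom) :
    EDelta (Iff (Delta phi) (Delta (Neg phi)))
| EDelta_MP (phi psi : form Atom) :
    EDelta phi -> EDelta (Imp phi psi) -> EDelta psi
| EDelta_RE (phi psi : form Atom) :
    EDelta (Iff phi psi) -> EDelta (Iff (Delta phi) (Delta psi)).

Definition derivable (Atom : Type) (Gamma : set (form Atom))
    (phi : form Atom) : Prop :=
  exists Gamma0 : seq (form Atom),
    (forall psi, List.In psi Gamma0 -> Gamma psi) /\
    EDelta (Imp (bigAnd phi Gamma0) phi).

Record frame : Type := Frame {
  state : Type;
  state_nonempty : [set: state] !=set0;
  nbhd : state -> set (set state) }.

Definition c_frame (F : frame) : Prop :=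
  forall (s : state F) (X : set (state F)), nbhd s X -> nbhd s (~` X).

Record model (Atom : Type) : Type := Model {
  model_frame : frame;
  valuation : Atom -> set (state model_frame) }.

Fixpoint sat (Atom : Type) (M : model Atom) (s : state (model_frame M))
    (phi : form Atom) : Prop :=
  match phi with
  | Var p => valuation p s
  | Neg psi => ~ sat s psi
  | And psi chi => sat s psi /\ sat s chi
  | Delta psi => nbhd s [set t | sat t psi]
  end.

(* Main.v *)
(* Completeness is by a canonical model whose states are the maximal consistent
   sets [A], a neighborhood of [A] being the truth set of some [phi] with
   [Delta phi] in [A]. If [phi] and [psi] have the same truth set, they are
   provably equivalent by Lindenbaum's lemma, so by the congruence rule [A]
   contains both or neither of [Delta phi] and [Delta psi]; the axiom
   [Delta phi <-> Delta (Neg phi)] closes neighborhoods under complement. *)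
Require Import Defs.
From mathcomp Require Import all_boot all_classical.

Set Implicit Arguments.
Unset Strict Implicit.
Unset Printing Implicit Defensive.

Local Open Scope classical_set_scope.

(** * Soundness *)

Lemma sat_Imp (Atom : Type) (M : model Atom) (s : state (model_frame M))
    (phi psi : form Atom) :
  sat s (Imp phi psi) <-> (sat s phi -> sat s psi).
Proof.
split=> [/= nand sphi|imp [sphi npsi]]; last by apply: npsi; apply: imp.
by apply: contrapT => npsi; apply: nand.
Qed.

Lemma sat_Iff (Atom : Type) (M : model Atom) (s : state (model_frame M))
    (phi psi : form Atom) :
  sat s (Iff phi psi) <-> (sat s phi <-> sat s psi).
Proof.
by split=> [[/sat_Imp ? /sat_Imp ?]|[? ?]]; split=> //; apply/sat_Imp.
Qed.

Lemma sat_bigAnd (Atom : Type) (M : model Atom) (s : state (model_frame M))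
    (phi : form Atom) (l : seq (form Atom)) :
  (forall psi, List.In psi l -> sat s psi) -> sat s (bigAnd phi l).
Proof.
elim: l => [_ /= []//|a l IHl sl]; split; first by apply: sl; left.
by apply: IHl => psi psil; apply: sl; right.
Qed.

(** At a fixed state, the truth values of the formulas [sigma n] form a Boolean valuation, so
    instances of tautologies hold at every state. *)
Lemma sat_psubst (Atom : Type) (M : model Atom) (s : state (model_frame M))
    (sigma : nat -> form Atom) (a : pform) :
  sat s (psubst sigma a) <-> peval (fun n => `[< sat s (sigma n) >]) a.
Proof.
elim: a => [n|b IHb|b IHb c IHc] /=.
- by split=> /asboolP.
- by split=> [nb|/negP nb /IHb//]; apply/negP => /IHb.
- by split=> [[/IHb -> /IHc ->]|/andP[/IHb ? /IHc ?]].
Qed.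

(** The state is quantified inside the induction: the congruence rule needs its premise at all
    states, to make two truth sets equal. *)
Lemma EDelta_sound (Atom : Type) (M : model Atom) (phi : form Atom) :
  c_frame (model_frame M) -> EDelta phi ->
  forall s : state (model_frame M), sat s phi.
Proof.
move=> cM; elim=> {phi} [a sigma ta|phi|phi psi _ sphi _ simp|phi psi _ siff] s.
- by apply/sat_psubst; apply: ta.
- have setN : [set t | sat t (Neg phi)] = ~` [set t | sat t phi] by [].
  apply/sat_Iff; rewrite /sat -/sat; split; first by move=> /cM.
  (* The converse is the frame condition again, applied to the complement, since complementation is
     an involution. *)
  by move=> /cM; rewrite setN setCK.
- by move/sat_Imp: (simp s); apply.
- apply/sat_Iff; rewrite /sat -/sat.
  suff -> : [set t | @sat _ M t phi] = [set t | sat t psi] by [].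
  by apply/seteqP; split=> t /=; case/sat_Iff: (siff t).
Qed.

(** * Propositional theorems of the system *)

Definition PImp (a b : pform) : pform := PNeg (PAnd a (PNeg b)).

(** With the substitution given as a list lookup, [psubst] computes to the desired schema, leaving
    only a truth table over three variables. *)
Lemma EDelta_taut3 (Atom : Type) (a : pform) (phi psi chi : form Atom) :
  tautology a -> EDelta (psubst (nth phi [:: phi; psi; chi]) a).
Proof. exact: EDelta_taut. Qed.

Local Notation P0 := (PVar 0).
Local Notation P1 := (PVar 1).
Local Notation P2 := (PVar 2).

Local Ltac truth_table :=
  let v := fresh "v" in
  by move=> v /=; case: (v 0); case: (v 1); case: (v 2).

Lemma EDelta_K (Atom : Type) (phi psi : form Atom) :
  EDelta (Imp phi (Imp psi phi)).
Proof.
by apply: (@EDelta_taut3 _ (PImp P0 (PImp P1 P0)) phi psi phi); truth_table.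
Qed.

Lemma EDelta_S (Atom : Type) (phi psi chi : form Atom) :
  EDelta (Imp (Imp phi (Imp psi chi)) (Imp (Imp phi psi) (Imp phi chi))).
Proof.
apply: (@EDelta_taut3 _ (PImp (PImp P0 (PImp P1 P2))
  (PImp (PImp P0 P1) (PImp P0 P2))) phi psi chi).
truth_table.
Qed.

Lemma EDelta_I (Atom : Type) (phi : form Atom) : EDelta (Imp phi phi).
Proof. by apply: (@EDelta_taut3 _ (PImp P0 P0) phi phi phi); truth_table. Qed.

Lemma EDelta_explosion (Atom : Type) (phi psi : form Atom) :
  EDelta (Imp (Neg phi) (Imp phi psi)).
Proof.
apply: (@EDelta_taut3 _ (PImp (PNeg P0) (PImp P0 P1)) phi psi phi).
truth_table.
Qed.

Lemma EDelta_cases (Atom : Type) (phi psi : form Atom) :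
  EDelta (Imp (Imp phi psi) (Imp (Imp (Neg phi) psi) psi)).
Proof.
apply: (@EDelta_taut3 _ (PImp (PImp P0 P1) (PImp (PImp (PNeg P0) P1) P1))
  phi psi phi).
truth_table.
Qed.

Lemma EDelta_andI (Atom : Type) (phi psi : form Atom) :
  EDelta (Imp phi (Imp psi (And phi psi))).
Proof.
apply: (@EDelta_taut3 _ (PImp P0 (PImp P1 (PAnd P0 P1))) phi psi phi).
truth_table.
Qed.

Lemma EDelta_andl (Atom : Type) (phi psi : form Atom) :
  EDelta (Imp (And phi psi) phi).
Proof.
by apply: (@EDelta_taut3 _ (PImp (PAnd P0 P1) P0) phi psi phi); truth_table.
Qed.

Lemma EDelta_andr (Atom : Type) (phi psi : form Atom) :
  EDelta (Imp (And phi psi) psi).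
Proof.
by apply: (@EDelta_taut3 _ (PImp (PAnd P0 P1) P1) phi psi phi); truth_table.
Qed.

Lemma EDelta_weaken (Atom : Type) (phi psi : form Atom) :
  EDelta phi -> EDelta (Imp psi phi).
Proof. by move=> dphi; apply: EDelta_MP dphi (EDelta_K _ _). Qed.

Lemma EDelta_Imp_MP (Atom : Type) (phi psi chi : form Atom) :
  EDelta (Imp phi psi) -> EDelta (Imp phi (Imp psi chi)) ->
  EDelta (Imp phi chi).
Proof.
by move=> d1 d2; apply: EDelta_MP d1 (EDelta_MP d2 (EDelta_S _ _ _)).
Qed.

Lemma EDelta_bigAnd_In (Atom : Type) (phi psi : form Atom)
    (l : seq (form Atom)) :
  List.In psi l -> EDelta (Imp (bigAnd phi l) psi).
Proof.
elim: l => [//|a l IHl] [->|/IHl dpsi]; first exact: EDelta_andl.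
exact: EDelta_Imp_MP (EDelta_andr _ _) (EDelta_weaken _ dpsi).
Qed.

(** * Derivations from a set of hypotheses *)

(** An inductive form of [derivable], free of finite lists. The congruence rule enters only through
    [deriv_thm], hence never acts on hypotheses, and the deduction theorem holds. *)
Inductive deriv (Atom : Type) (A : set (form Atom)) : form Atom -> Prop :=
| deriv_hyp phi : A phi -> deriv A phi
| deriv_thm phi : EDelta phi -> deriv A phi
| deriv_MP phi psi : deriv A phi -> deriv A (Imp phi psi) -> deriv A psi.

Lemma deriv_sub (Atom : Type) (A B : set (form Atom)) (phi : form Atom) :
  A `<=` B -> deriv A phi -> deriv B phi.
Proof.
move=> AB; elim=> {phi} [phi /AB|phi|phi psi _ + _]; first exact: deriv_hyp.
- exact: deriv_thm.
- exact: deriv_MP.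
Qed.

Lemma deriv_thm1 (Atom : Type) (A : set (form Atom)) (phi psi : form Atom) :
  EDelta (Imp phi psi) -> deriv A phi -> deriv A psi.
Proof. by move=> /(deriv_thm A) + dphi; apply: deriv_MP. Qed.

Lemma deriv_thm2 (Atom : Type) (A : set (form Atom)) (phi psi chi : form Atom) :
  EDelta (Imp phi (Imp psi chi)) -> deriv A phi -> deriv A psi -> deriv A chi.
Proof. by move=> /deriv_thm1 th /th + dpsi; apply: deriv_MP. Qed.

Lemma deriv_set0 (Atom : Type) (phi : form Atom) : deriv set0 phi -> EDelta phi.
Proof. by elim=> {phi} [//|//|phi psi _ + _]; apply: EDelta_MP. Qed.

Lemma deduction (Atom : Type) (A : set (form Atom)) (phi psi : form Atom) :
  deriv (phi |` A) psi -> deriv A (Imp phi psi).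
Proof.
elim=> {psi} [psi [->|Apsi]|psi dpsi|psi chi _ IH1 _ IH2].
- exact/deriv_thm/EDelta_I.
- exact: deriv_thm1 (EDelta_K _ _) (deriv_hyp Apsi).
- exact/deriv_thm/EDelta_weaken.
- exact: deriv_thm2 (EDelta_S _ _ _) IH2 IH1.
Qed.

Lemma deriv_finite (Atom : Type) (A : set (form Atom)) (phi : form Atom) :
  deriv A phi -> exists l : seq (form Atom),
    (forall psi, List.In psi l -> A psi) /\ deriv [set psi | List.In psi l] phi.
Proof.
elim=> {phi} [phi Aphi|phi dphi|phi psi _ [l1 [l1A d1]] _ [l2 [l2A d2]]].
- exists [:: phi]; split; first by move=> psi [<-|].
  by apply: deriv_hyp; left.
- by exists [::]; split => //; apply: deriv_thm.
- exists (l1 ++ l2); split.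
    by move=> chi /(@List.in_app_or _ l1 l2) [/l1A|/l2A].
  apply: (@deriv_MP _ _ phi).
    apply: deriv_sub d1 => chi /= chil.
    by apply/(@List.in_or_app _ l1 l2); left.
  apply: deriv_sub d2 => chi /= chil.
  by apply/(@List.in_or_app _ l1 l2); right.
Qed.

(** The formula [chi] that ends the conjunction is kept apart from [phi], so that the antecedent
    stays fixed while the induction runs through the intermediate formulas. *)
Lemma deriv_bigAnd (Atom : Type) (l : seq (form Atom)) (phi chi : form Atom) :
  deriv [set psi | List.In psi l] phi -> EDelta (Imp (bigAnd chi l) phi).
Proof.
elim=> {phi} [phi|phi|phi psi _ + _]; first exact: EDelta_bigAnd_In.
- exact: EDelta_weaken.
- exact: EDelta_Imp_MP.
Qed.

Lemma deriv_derivable (Atom : Type) (A : set (form Atom)) (phi : form Atom) :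
  deriv A phi -> derivable A phi.
Proof.
move=> /deriv_finite [l [lA dphi]]; exists l; split=> //.
exact: deriv_bigAnd.
Qed.

(* The disjunct [X = set0] accounts for the empty chain. *)
Lemma deriv_chain (Atom : Type) (G : set (form Atom))
    (F : set (set (form Atom))) (phi : form Atom) :
  total_on F subset -> deriv (G `|` \bigcup_(X in F) X) phi ->
  exists2 X, X = set0 \/ F X & deriv (G `|` X) phi.
Proof.
move=> totF; elim=> {phi} [phi [Gphi|[X FX Xphi]]|phi dphi|].
- by exists set0; [left|apply: deriv_hyp; left].
- by exists X; [right|apply: deriv_hyp; right].
- by exists set0; [left|apply: deriv_thm].
move=> phi psi _ [X FX dX] _ [Y FY dY].
have [XY|YX] : X `<=` Y \/ Y `<=` X.
  case: FX FY => [->|FX] [->|FY]; [by left|by left|by right|exact: totF].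
- by exists Y => //; apply: deriv_MP dY; apply: deriv_sub dX; apply: setUS.
- by exists X => //; apply: deriv_MP dX _; apply: deriv_sub dY; apply: setUS.
Qed.

(** * Maximal consistent sets *)

(** In the second clause, left to right is consistency and right to left is maximality. *)
Definition mcs (Atom : Type) (A : set (form Atom)) : Prop :=
  (forall phi, deriv A phi -> A phi) /\ (forall phi, A (Neg phi) <-> ~ A phi).

(** By Zorn's lemma, take the extension maximal among those not deriving [phi]. Every [psi] outside
    it then satisfies [psi -> phi] derivably. So a derivable [psi] cannot lie outside, and neither
    can both [psi] and [Neg psi], by case distinction. *)
Lemma Lindenbaum (Atom : Type) (G : set (form Atom)) (phi : form Atom) :
  ~ deriv G phi -> exists A, [/\ mcs A, G `<=` A & ~ A phi].
Proof.
move=> nG.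
(* The sets [B] are additions to [G] rather than supersets of it, so that the empty union, coming
   from the empty chain, is also admissible. *)
have [F FP totF|A [nA maxA]] := @Zorn_bigcup _ [set B | ~ deriv (G `|` B) phi].
  move=> /(deriv_chain totF) [X [->|/FP//]].
  by rewrite setU0.
have Imp_phi psi : ~ (G `|` A) psi -> deriv (G `|` A) (Imp psi phi).
  move=> npsi; apply: deduction; apply: contrapT => nd.
  apply: (maxA (psi |` A)); last by rewrite /= setUCA.
  split; first exact: subsetUr.
  by move=> sub; apply: npsi; right; apply: sub; left.
exists (G `|` A); split; last 1 first.
- by move=> /deriv_hyp.
- split=> psi.
    move=> dpsi; apply: contrapT => /Imp_phi dimp.
    exact: nA (deriv_MP dpsi dimp).
  split=> [Anpsi Apsi|npsi].
    apply: nA.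
    exact: deriv_thm2 (EDelta_explosion _ _) (deriv_hyp Anpsi) (deriv_hyp Apsi).
  apply: contrapT => /Imp_phi dneg; apply: nA.
  exact: deriv_thm2 (EDelta_cases _ _) (Imp_phi _ npsi) dneg.
- exact: subsetUl.
Qed.

Lemma mcs_And (Atom : Type) (A : set (form Atom)) (phi psi : form Atom) :
  mcs A -> A (And phi psi) <-> A phi /\ A psi.
Proof.
move=> [clA _]; split=> [/deriv_hyp dand|[/deriv_hyp d1 /deriv_hyp d2]].
  split; apply: clA.
    exact: deriv_thm1 (EDelta_andl _ _) dand.
  exact: deriv_thm1 (EDelta_andr _ _) dand.
by apply: clA; apply: deriv_thm2 (EDelta_andI _ _) d1 d2.
Qed.

Lemma mcs_Iff (Atom : Type) (A : set (form Atom)) (phi psi : form Atom) :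
  mcs A -> EDelta (Iff phi psi) -> A phi <-> A psi.
Proof.
move=> [clA _] iff; split=> /deriv_hyp d; apply: clA; apply: deriv_thm1 d.
  exact: EDelta_MP iff (EDelta_andl _ _).
exact: EDelta_MP iff (EDelta_andr _ _).
Qed.

(** If the implication is not a theorem, the deduction theorem shows that [phi] alone does not
    derive [psi], and Lindenbaum's lemma gives a maximal consistent set with [phi] but without
    [psi]. *)
Lemma EDelta_Imp_mcs (Atom : Type) (phi psi : form Atom) :
  (forall A, mcs A -> A phi -> A psi) -> EDelta (Imp phi psi).
Proof.
move=> sub; apply/deriv_set0/deduction; apply: contrapT.
move=> /Lindenbaum [A [mA phiA nApsi]]; apply: nApsi.
by apply: sub => //; apply: phiA; left.
Qed.

Lemma EDelta_Iff_mcs (Atom : Type) (phi psi : form Atom) :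
  (forall A, mcs A -> A phi <-> A psi) -> EDelta (Iff phi psi).
Proof.
move=> iff.
have d1 : EDelta (Imp phi psi)
  by apply: EDelta_Imp_mcs => A mA; case: (iff A mA).
have d2 : EDelta (Imp psi phi)
  by apply: EDelta_Imp_mcs => A mA; case: (iff A mA).
exact: EDelta_MP d2 (EDelta_MP d1 (EDelta_andI _ _)).
Qed.

(** * The canonical model and completeness *)

Definition canonical_state (Atom : Type) : Type :=
  {A : set (form Atom) | mcs A}.

Definition truth_set (Atom : Type) (phi : form Atom) :
  set (canonical_state Atom) := [set A | sval A phi].

Definition canonical_nbhd (Atom : Type) (A : canonical_state Atom) :
    set (set (canonical_state Atom)) :=
  [set X | exists2 phi, X = truth_set phi & sval A (Delta phi)].

(** The parameter [A0] serves as the witness that the frame is nonempty. *)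
Definition canonical_model (Atom : Type) (A0 : canonical_state Atom) :
    model Atom :=
  @Model Atom
    (@Frame (canonical_state Atom) (ex_intro _ A0 I) (@canonical_nbhd Atom))
    (fun p => truth_set (Var p)).

Lemma truth_setN (Atom : Type) (phi : form Atom) :
  truth_set (Neg phi) = ~` truth_set phi.
Proof. by apply/seteqP; split=> -[A mA] /(mA.2 phi). Qed.

Lemma canonical_c_frame (Atom : Type) (A0 : canonical_state Atom) :
  c_frame (model_frame (canonical_model A0)).
Proof.
move=> A _ [phi -> Aphi]; exists (Neg phi); first by rewrite truth_setN.
exact/(mcs_Iff (svalP A) (EDelta_equ phi)).
Qed.

Lemma canonical_nbhdE (Atom : Type) (A : canonical_state Atom)
    (phi : form Atom) :
  canonical_nbhd A (truth_set phi) <-> sval A (Delta phi).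
Proof.
split=> [[psi eqX Apsi]|]; last by exists phi.
suff /EDelta_RE iff : EDelta (Iff phi psi) by apply/(mcs_Iff (svalP A) iff).
apply: EDelta_Iff_mcs => B mB.
suff : truth_set phi (exist _ B mB) <-> truth_set psi (exist _ B mB) by [].
by rewrite eqX.
Qed.

Lemma truth_lemma (Atom : Type) (A0 A : canonical_state Atom)
    (phi : form Atom) :
  @sat Atom (canonical_model A0) A phi <-> sval A phi.
Proof.
elim: phi A => [p|phi IH|phi IH1 psi IH2|phi IH] A //.
- by rewrite /sat -/sat IH; split=> /((svalP A).2 phi).
- by rewrite /sat -/sat IH1 IH2; split=> /(mcs_And phi psi (svalP A)).
(* The induction hypothesis, available at all states, identifies the set of states satisfying [phi]
   with its truth set. *)
- rewrite -canonical_nbhdE /sat -/sat.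
  suff -> : [set t | @sat _ (canonical_model A0) t phi] = truth_set phi by [].
  by apply/seteqP; split=> t /= /IH.
Qed.

Theorem theorem5 (Atom : Type) (Atom_countable : countable [set: Atom])
    (Gamma : set (form Atom)) (phi : form Atom) :
  derivable Gamma phi <->
  (forall M : model Atom, c_frame (model_frame M) ->
   forall s : state (model_frame M),
     (forall psi : form Atom, Gamma psi -> sat s psi) -> sat s phi).
Proof.
split=> [[l [lGamma dphi]] M cM s sGamma|valid].
  have /sat_Imp := EDelta_sound cM dphi s; apply.
  by apply: sat_bigAnd => psi /lGamma /sGamma.
apply: deriv_derivable; apply: contrapT => /Lindenbaum [A [mA GammaA nAphi]].
(* The same set inhabits the frame and is the state where validity is tested: it satisfies all of
   [Gamma], so it would have to contain [phi]. *)
apply: nAphi; pose A0 : canonical_state Atom := exist _ A mA.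
apply/(truth_lemma A0 A0).
apply: (valid _ (@canonical_c_frame _ A0)) => psi Gpsi.
by apply/truth_lemma; apply: GammaA.
Qed.
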